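(* Consider the PP-LUCB algorithm described in the context, with the stopping rule: stop at the first time $t$ such that $L_{b(t)}(t)>\max_{k\neq b(t)}U_k(t)$, and output $\widehat{k}=b(t)$. If the confidence sequences satisfy simultaneous coverage, $$\mathbb{P}\big(\forall t\ge1,\ \forall k\in[K]:\ \theta_k\in[L_k(t),U_k(t)]\big)\ge1-\delta,$$ and the auditing policy satisfies audit ignorability and positivity (as stated in the context), then the algorithm is $\delta$-correct: $$\mathbb{P}(\widehat{k}=k^\star)\ge1-\delta.$$
   Context: Model. There are $K$ arms $k\in[K]=\{1,\dots,K\}$ and contexts drawn from a distribution $\mathcal{D}$ on $\mathcal{X}$. For each arm $k$ and context $x$ there are a judge score $F(k,x)\in[0,1]$ (observed at cost $c_F>0$ on each pull) and a human audit outcome $Y(k,x)\in[0,1]$ (observed only if audited, at additional cost $c_Y>0$). Put $\theta_k=\mathbb{E}_{X\sim\mathcal{D}}[Y(k,X)]$, and let $k^\star\in\arg\max_{k\in[K]}\theta_k$ be any arm achieving the maximum. A (random) stopping time and output $\widehat{k}$ are called $\delta$-correct if $\mathbb{P}(\widehat{k}=k^\star)\ge1-\delta$. Pulls and auditing. In pull $t$, with arm $k_t$ and context $X_t\sim\mathcal{D}$, the score $F_t=F(k_t,X_t)$ is observed and an audit decision $A_t\in\{0,1\}$ is made with propensity $\pi_t=\mathbb{P}(A_t=1\mid\mathcal{F}_{t-1},k_t,X_t,F_t)$, where $\mathcal{F}_{t-1}$ is the history of all earlier observations; if $A_t=1$, $Y_t=Y(k_t,X_t)$ is observed. Audit ignorability: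 for each $t$, conditional on $(\mathcal{F}_{t-1},k_t,X_t,F_t)$, $A_t$ is independent of $Y(k_t,X_t)$. Positivity: there exists $\pi_{\min}\in(0,1]$ such that $\pi_t\ge\pi_{\min}$ whenever an arm-context pair is eligible for auditing. PP-LUCB algorithm. Inputs: arms $[K]$, confidence $\delta$, costs $(c_F,c_Y)$, $\pi_{\min}>0$, a target audit rate $\rho\in[\pi_{\min},1]$, and an initial estimator $\widehat{s}_k(x,f)$ of $\sqrt{\mathbb{E}[(Y-F)^2\mid k,X=x,F=f]}$. Initialization: sample each arm and audit with probability $\pi_{\min}$. Then for $t=1,2,3,\dots$: (1) update $\widehat{\theta}_k(t)$ and $[L_k(t),U_k(t)]$; (2) let $b(t)\in\arg\max_k\widehat{\theta}_k(t)$ and $c(t)\in\arg\max_{k\ne b(t)}U_k(t)$; (3) if $L_{b(t)}(t)>\max_{k\ne b(t)}U_k(t)$, return $\widehat{k}=b(t)$; (4) for each $k\in\{b(t),c(t)\}$: draw $X\sim\mathcal{D}$, observe $F=F(k,X)$ and pay $c_F$; compute $\widehat{s}_k(X,F)$; set $\pi$ to the clipping of $\lambda_t\widehat{s}_k(X,F)$ to $[\pi_{\min},1]$, where $\lambda_t$ is a coefficient ensuring that the average audit rate equals $\rho$; draw $A\sim\mathrm{Bernoulli}(\pi)$ and, if $A=1$, observe $Y$ and pay $c_Y$; update $\widehat{s}_k$ from the audited data. The theorem is stated for any auditing policy satisfying audit ignorability and positivity in place of the specific choice of $\pi$ in step (4). Estimators and intervals. Let $N_k(t)$ be the number of pulls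 of arm $k$ up to time $t$; with sums over the pulls $s$ up to time $t$ with $k_s=k$, let $R_s=\frac{A_s}{\pi_s}(Y_s-F_s)$, $\widehat{\theta}_k(t)=\frac1{N_k(t)}\sum_sF_s+\frac1{N_k(t)}\sum_sR_s$, $\widehat{V}_{R,k}(t)=\sum_sR_s^2$, $\delta_k=\delta/K$, $M=2/\pi_{\min}$, and $$w_{F,k}(t)=\frac{\psi(N_k(t)/4;\delta_k/2)}{N_k(t)},\qquad w_{R,k}(t)=\frac1{N_k(t)}\Big(\psi(\widehat{V}_{R,k}(t);\delta_k/2)+0.45\,M\log\big(\tfrac{10.4}{\delta_k}\big)\Big),$$ where $\psi(v;\alpha)=1.7\sqrt{v\left(\log\log(2v)+0.72\log\frac{5.2}{\alpha}\right)}$. Then $L_k(t)=\widehat{\theta}_k(t)-w_{F,k}(t)-w_{R,k}(t)$ and $U_k(t)=\widehat{\theta}_k(t)+w_{F,k}(t)+w_{R,k}(t)$.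
   Formalization: With tied best arms the algorithm never stops on the coverage event, so the claim fails; the bound P(k̂ = k* ) ≥ 1−δ is proved when the maximizer k* is unique, and for any maximizer in the form P(no stop or k̂ = k* ) ≥ 1−δ. *)

(* Defs.v *)
From HB Require Import structures.
From mathcomp Require Import all_boot all_order all_algebra.
From mathcomp Require Import all_classical all_reals all_analysis.
Set Implicit Arguments.
Unset Strict Implicit.
Unset Printing Implicit Defensive.
Import Order.TTheory GRing.Theory Num.Theory.
Local Open Scope classical_set_scope.
Local Open Scope ring_scope.

(* A unit is a pair (x, z) of a context x and a latent part z, never observed,
   that carries whatever randomness F(k, x) and Y(k, x) retain once x is fixed.
   Deterministic scores and outcomes are those that ignore z. *)
Record bandit (R : realType) (K : nat) (dX dZ : measure_display)
    (X : measurableType dX) (Z : measurableType dZ) := Bandit {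
  context_law : probability X R;
  latent_law : probability Z R;
  score : 'I_K -> X * Z -> R;
  outcome : 'I_K -> X * Z -> R;
  score_measurable : forall k, measurable_fun [set: X * Z] (score k);
  outcome_measurable : forall k, measurable_fun [set: X * Z] (outcome k);
  score_itv : forall k u, 0 <= score k u <= 1;
  outcome_itv : forall k u, 0 <= outcome k u <= 1 }.

Definition theta (R : realType) (K : nat) (dX dZ : measure_display)
    (X : measurableType dX) (Z : measurableType dZ)
    (B : bandit R K X Z) (k : 'I_K) : R :=
  \int[(context_law B \x latent_law B)%E]_u outcome B k u.

Definition best_arm (R : realType) (K : nat) (dX dZ : measure_display)
    (X : measurableType dX) (Z : measurableType dZ)
    (B : bandit R K X Z) (k : 'I_K) : Prop :=
  forall j, theta B j <= theta B k.

Section ConditionalProbability.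
Context (R : realType) (d : measure_display) (T : measurableType d).
Implicit Types (P : probability T R) (G : set (set T)).

Definition measurable_wrt G (f : T -> R) : Prop :=
  forall S : set R, measurable S -> G (f @^-1` S).

(* p is a version of P(E | G) *)
Definition is_cond_prob P G (E : set T) (p : T -> R) : Prop :=
  measurable_wrt G p /\
  forall H, G H -> (\int[P]_(w in H) (p w)%:E = P (E `&` H))%E.

Definition cond_indep P G (S1 S2 : set (set T)) : Prop :=
  forall E1 E2, S1 E1 -> S2 E2 -> exists p q : T -> R,
    [/\ is_cond_prob P G E1 p, is_cond_prob P G E2 q &
        is_cond_prob P G (E1 `&` E2) (fun w => p w * q w)].

End ConditionalProbability.

(* Pulls are numbered 0, 1, 2, ... over initialization and rounds together;
   rounds are numbered 1, 2, 3, ... *)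
Record process (R : realType) (K : nat) (dX dZ d : measure_display)
    (X : measurableType dX) (Z : measurableType dZ) (T : measurableType d) :=
  Process {
  arm : nat -> T -> 'I_K;
  ctx : nat -> T -> X;
  latent : nat -> T -> Z;
  audit : nat -> T -> bool;
  propensity : nat -> T -> R;
  leader : nat -> T -> 'I_K;
  challenger : nat -> T -> 'I_K }.

Section Process.
Context (R : realType) (K : nat) (dX dZ d : measure_display).
Context (X : measurableType dX) (Z : measurableType dZ) (T : measurableType d).
Variables (B : bandit R K X Z) (r : process R K X Z T).

Definition pull_score (s : nat) (w : T) : R :=
  score B (arm r s w) (ctx r s w, latent r s w).

Definition pull_outcome (s : nat) (w : T) : R :=
  outcome B (arm r s w) (ctx r s w, latent r s w).

Definition arm_events (s : nat) : set (set T) :=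
  [set (arm r s @^-1` S) | S in [set: set 'I_K]].

Definition ctx_events (s : nat) : set (set T) :=
  preimage_set_system [set: T] (ctx r s) measurable.

Definition score_events (s : nat) : set (set T) :=
  preimage_set_system [set: T] (pull_score s) measurable.

Definition audit_events (s : nat) : set (set T) :=
  preimage_set_system [set: T] (audit r s) measurable.

Definition outcome_events (s : nat) : set (set T) :=
  preimage_set_system [set: T] (pull_outcome s) measurable.

(* The outcome is in the history only on the event that it was audited. *)
Definition audited_outcome_events (s : nat) : set (set T) :=
  preimage_set_system [set: T]
    (fun w => if audit r s w then pull_outcome s w else 0) measurable.

Definition history_events (n : nat) : set (set T) :=
  \bigcup_(s in [set s | (s < n)%N])
    (arm_events s `|` ctx_events s `|` score_events s `|`
     audit_events s `|` audited_outcome_events s).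

(* sigma(F_{s-1}, k_s) *)
Definition before_unit (s : nat) : set (set T) :=
  <<s history_events s `|` arm_events s >>.

(* sigma(F_{s-1}, k_s, X_s, F_s) *)
Definition before_audit (s : nat) : set (set T) :=
  <<s history_events s `|` arm_events s `|` ctx_events s `|` score_events s >>.

Definition audit_ignorability (P : probability T R) : Prop :=
  forall s, cond_indep P (before_audit s) (audit_events s) (outcome_events s).

Definition positivity (pimin : R) : Prop :=
  forall s w, pimin <= propensity r s w.

(* Number of pulls made when the statistics of round t are computed:
   K in the initialization, then two in each of the rounds 1, ..., t - 1. *)
Definition pulls_before (t : nat) : nat := (K + 2 * t.-1)%N.

Definition npulls (k : 'I_K) (t : nat) (w : T) : nat :=
  (\sum_(0 <= s < pulls_before t | arm r s w == k) 1)%N.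

Definition residual (s : nat) (w : T) : R :=
  (audit r s w)%:R / propensity r s w * (pull_outcome s w - pull_score s w).

Definition theta_hat (k : 'I_K) (t : nat) (w : T) : R :=
  (npulls k t w)%:R^-1 *
    (\sum_(0 <= s < pulls_before t | arm r s w == k) pull_score s w) +
  (npulls k t w)%:R^-1 *
    (\sum_(0 <= s < pulls_before t | arm r s w == k) residual s w).

Definition residual_variation (k : 'I_K) (t : nat) (w : T) : R :=
  \sum_(0 <= s < pulls_before t | arm r s w == k) residual s w ^+ 2.

(* Outside its natural domain the formula is read with ln x = 0 for x <= 0 and
   Num.sqrt x = 0 for x <= 0; this happens only for v close to or below 1/2. *)
Definition psi (v alpha : R) : R :=
  17 / 10 * Num.sqrt (v * (ln (ln (2 * v)) + 72 / 100 * ln (52 / 10 / alpha))).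

Section Intervals.
Variables (delta pimin : R).

Definition delta_arm : R := delta / K%:R.

Definition width_score (k : 'I_K) (t : nat) (w : T) : R :=
  psi ((npulls k t w)%:R / 4) (delta_arm / 2) / (npulls k t w)%:R.

Definition width_residual (k : 'I_K) (t : nat) (w : T) : R :=
  (npulls k t w)%:R^-1 *
    (psi (residual_variation k t w) (delta_arm / 2) +
     45 / 100 * (2 / pimin) * ln (104 / 10 / delta_arm)).

Definition lower (k : 'I_K) (t : nat) (w : T) : R :=
  theta_hat k t w - width_score k t w - width_residual k t w.

Definition upper (k : 'I_K) (t : nat) (w : T) : R :=
  theta_hat k t w + width_score k t w + width_residual k t w.

(* For K = 1 the maximum of the upper bounds over the other arms is -oo. *)
Definition stops (t : nat) (w : T) : bool :=
  [forall k, (k != leader r t w) ==> (upper k t w < lower (leader r t w) t w)].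

Definition stop_round (t : nat) (w : T) : bool := (0 < t)%N && stops t w.

Definition output (w : T) : option 'I_K :=
  if pselect (exists t, stop_round t w) is left e
  then Some (leader r (ex_minn e) w) else None.

(* The choice of audit propensities after the initialization is left free.  So
   is the choice of arms after the stopping time, where pulls only serve to
   make the statistics of every round t >= 1 meaningful. *)
Record pplucb (P : probability T R) : Prop := PPLUCB {
  arm_measurable : forall s k, measurable (arm r s @^-1` [set k]);
  ctx_measurable : forall s, measurable_fun [set: T] (ctx r s);
  latent_measurable : forall s, measurable_fun [set: T] (latent r s);
  audit_measurable : forall s, measurable_fun [set: T] (audit r s);
  leader_measurable : forall t k, measurable (leader r t @^-1` [set k]);
  challenger_measurable : forall t k,
    measurable (challenger r t @^-1` [set k]);
  unit_law : forall s H (S : set (X * Z)), before_unit s H -> measurable S ->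
    (P (H `&` [set w | S (ctx r s w, latent r s w)]) =
     P H * (context_law B \x latent_law B) S)%E;
  propensityP : forall s,
    is_cond_prob P (before_audit s) [set w | audit r s w] (propensity r s);
  init_arm : forall k w, exists2 s, (s < K)%N & arm r s w = k;
  init_propensity : forall s w, (s < K)%N -> propensity r s w = pimin;
  leaderP : forall t w k, (0 < t)%N ->
    theta_hat k t w <= theta_hat (leader r t w) t w;
  challengerP : forall t w, (0 < t)%N ->
    (forall t', (t' <= t)%N -> ~~ stop_round t' w) ->
    challenger r t w != leader r t w /\
    forall k, k != leader r t w -> upper k t w <= upper (challenger r t w) t w;
  round_arms : forall t w, (0 < t)%N ->
    (forall t', (t' <= t)%N -> ~~ stop_round t' w) ->
    arm r (pulls_before t) w = leader r t w /\
    arm r (pulls_before t).+1 w = challenger r t w }.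

Definition simultaneous_coverage (P : probability T R) : Prop :=
  ((1 - delta)%:E <= P [set w | forall t, (0 < t)%N -> forall k,
     (lower k t w <= theta B k <= upper k t w)%R])%E.

Definition delta_correct (P : probability T R) (kstar : 'I_K) : Prop :=
  ((1 - delta)%:E <= P [set w | output w = Some kstar])%E.

(* A run that never stops has no output and counts as no error. *)
Definition delta_correct_if_stopped (P : probability T R) (kstar : 'I_K)
    : Prop :=
  ((1 - delta)%:E <= P [set w | forall k, output w = Some k -> k = kstar])%E.

End Intervals.
End Process.

(* Main.v *)
(* On the coverage event everything is deterministic.  If the run stops with
   leader b different from a best arm k*, then
   U_{k*} < L_b <= theta_b <= theta_{k*} <= U_{k*}, which is absurd.
   If the best arm is unique, the run must stop.  Otherwise, as two distinct
   arms are pulled in every round, some round has a leader b and a challenger c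
   that were both pulled so often that their widths are below an eighth of the
   gap of k* (the residuals are bounded by 1 / pimin, and psi(v) = o(v)).  Not
   stopping means U_c >= L_b, so theta_b and theta_c are closer than the gap,
   and k* can be neither b nor c; but then U_c >= U_{k*} >= theta_{k*} puts
   theta_c within the gap of theta_{k*}.
   The law P enters only through monotonicity, which requires the coverage
   event and the output events to be measurable. *)

Require Import Defs.
From HB Require Import structures.
From mathcomp Require Import all_boot all_order all_algebra.
From mathcomp Require Import all_classical all_reals all_analysis.
From mathcomp Require Import measurable_realfun ring lra.
Set Implicit Arguments.
Unset Strict Implicit.
Unset Printing Implicit Defensive.
Import Order.TTheory GRing.Theory Num.Theory.
Local Open Scope classical_set_scope.
Local Open Scope ring_scope.

(** * Measurability of finite selections, inverses and [psi] *)

(** A preimage splits over the finitely many values of the index [a]. This lets a random arm or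
    leader be treated as a fixed one, without a sigma-algebra on [I]. *)
Lemma measurable_fun_select (d d' : measure_display) (T : measurableType d)
    (T' : measurableType d') (I : finType) (a : T -> I) (f : I -> T -> T') :
  (forall i, measurable (a @^-1` [set i])) ->
  (forall i, measurable_fun [set: T] (f i)) ->
  measurable_fun [set: T] (fun w => f (a w) w).
Proof.
move=> ma mf mT Y mY; rewrite setTI.
rewrite (_ : _ @^-1` _ = \bigcup_(i in [set: I]) (a @^-1` [set i] `&` (f i @^-1` Y))).
  apply: fin_bigcup_measurable; first exact: finite_finset.
  by move=> i _; apply: measurableI => //; rewrite -[X in measurable X]setTI; exact: mf.
by apply/seteqP; split=> w /= => [Yw|[i _ [/= -> //]]]; exists (a w).
Qed.

Lemma measurable_fun_forall (d : measure_display) (T : measurableType d)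
    (I : finType) (p : I -> T -> bool) :
  (forall i, measurable_fun [set: T] (p i)) ->
  measurable_fun [set: T] (fun w => [forall i, p i w]).
Proof.
move=> mp; apply: (measurable_fun_bool true); rewrite setTI.
rewrite (_ : _ @^-1` _ = \bigcap_(i in [set: I]) (p i @^-1` [set true])).
  apply: fin_bigcap_measurable; first exact: finite_finset.
  by move=> i _; rewrite -[X in measurable X]setTI; exact: mp.
apply/seteqP; split=> w /= => [/forallP pw i _|pw]; first exact: pw.
by apply/forallP => i; exact: pw.
Qed.

Lemma measurable_funV (d : measure_display) (T : measurableType d)
    (R : realType) (f : T -> R) :
  measurable_fun [set: T] f -> measurable_fun [set: T] (fun w => (f w)^-1).
Proof.
move=> mf.
(* The square makes the base of the real power nonnegative, and the factor [f w] gives the right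
   value [0] where [f] vanishes. *)
rewrite (_ : (fun _ => _) = (fun w => f w * (f w ^+ 2) `^ (-1))).
  apply: measurable_funM => //.
  by apply: (measurableT_comp (measurable_powR (-1))); exact: measurable_funX.
apply/funext => w; rewrite powR_inv1 ?sqr_ge0//.
have [->|f0] := eqVneq (f w) 0; first by rewrite mul0r invr0.
by rewrite expr2 invfM mulVKf.
Qed.

Lemma measurable_psi (d : measure_display) (T : measurableType d)
    (R : realType) (alpha : R) (f : T -> R) :
  measurable_fun [set: T] f -> measurable_fun [set: T] (fun w => psi (f w) alpha).
Proof.
move=> mf; apply: measurable_funM => //.
apply: (@measurableT_comp _ _ _ _ _ _ (@Num.sqrt R)).
  by apply: continuous_measurable_fun; exact: sqrt_continuous.
apply: measurable_funM => //; apply: measurable_funD => //.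
apply: (measurableT_comp (@measurable_ln R)).
apply: (measurableT_comp (@measurable_ln R)).
exact: measurable_funM.
Qed.

(** * Sublinear growth of the width function [psi] *)

(* ln is 0 on the nonpositive reals, so v <= 1 is a genuine case here. *)
Lemma ln_ln_le_sqrt (R : realType) (v : R) : 0 <= v -> ln (ln v) <= 2 * Num.sqrt v.
Proof.
move=> v0; have [lnv|lnv] := leP (ln v) 0; first by rewrite ln0// mulr_ge0// sqrtr_ge0.
have v_gt0 : 0 < v by rewrite ltNge; apply/negP => /ln0 v1; rewrite v1 ltxx in lnv.
have sv_gt0 : 0 < Num.sqrt v by rewrite sqrtr_gt0.
apply: (le_trans (ltW (ln_sublinear lnv))).
(* After [ln (ln v) <= ln v], write [ln v] as twice [ln (Num.sqrt v)] and bound [ln] by the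
   identity. *)
rewrite -{1}(sqr_sqrtr v0) lnXn// -[leLHS]mulr_natl.
by rewrite ler_wpM2l// ltW// ln_sublinear.
Qed.

(** The iterated logarithm is at most of order [Num.sqrt v], so [psi] is of order at most [n^(3/4)]
    when [v <= A * n]. The threshold [N] is uniform in [v] because the residual variation is
    random. *)
Lemma psi_sublinear (R : realType) (A alpha eps : R) : 0 <= A -> 0 < eps ->
  exists N : nat, forall (n : nat) (v : R), (N <= n)%N ->
    0 <= v <= A * n%:R -> psi v alpha / n%:R <= eps.
Proof.
move=> A0 eps0; set c := `|72 / 100 * ln (52 / 10 / alpha)|.
set C := A * (2 * Num.sqrt (2 * A) + c).
have C0 : 0 <= C by rewrite /C mulr_ge0// addr_ge0// ?mulr_ge0// ?sqrtr_ge0// /c.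
pose D := 17 / 10 * Num.sqrt C.
have D0 : 0 <= D by rewrite /D mulr_ge0// sqrtr_ge0.
exists (Num.truncn ((D / eps) ^+ 4)).+2 => n v Nn /andP[v0 vn].
(* [h] is the fourth root of [n]. The bound to reach is [psi v alpha <= D * h ^+ 3], and the choice
   of [N] gives [D / h <= eps]. *)
pose h := Num.sqrt (Num.sqrt (n%:R : R)).
have h0 : 0 <= h by exact: sqrtr_ge0.
have h2 : h ^+ 2 = Num.sqrt n%:R by rewrite sqr_sqrtr// sqrtr_ge0.
have h4 : h ^+ 4 = n%:R by rewrite (exprM h 2 2) h2 sqr_sqrtr.
have n1 : 1 <= n%:R :> R by rewrite ler1n (leq_trans _ Nn).
have h1 : 1 <= h by rewrite -(@ler_pXn2r _ 4) ?nnegrE// expr1n h4.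
have hD : D / eps <= h.
  rewrite -(@ler_pXn2r _ 4) ?nnegrE ?divr_ge0 ?(ltW eps0)// h4.
  apply: ltW; apply: (lt_le_trans (truncnS_gt _)); rewrite ler_nat.
  by apply: leq_trans Nn.
(* The factor [v] costs [h ^+ 4] and the bracket [h ^+ 2]; since [h >= 1], the constant [c] is
   absorbed into [c * h ^+ 2]. *)
have vlnln : v * (ln (ln (2 * v)) + 72 / 100 * ln (52 / 10 / alpha)) <=
             C * (h ^+ 3) ^+ 2.
  apply: (@le_trans _ _ (v * (2 * Num.sqrt (2 * v) + c))).
    by rewrite ler_wpM2l// lerD// ?ler_norm// ln_ln_le_sqrt// mulr_ge0.
  have sv : Num.sqrt (2 * v) <= Num.sqrt (2 * A) * h ^+ 2.
    rewrite h2 -sqrtrM ?mulr_ge0// ler_wsqrtr//.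
    by rewrite -mulrA ler_wpM2l.
  apply: (@le_trans _ _ (A * h ^+ 4 * ((2 * Num.sqrt (2 * A) + c) * h ^+ 2))).
    apply: ler_pM => //; first by rewrite addr_ge0 ?mulr_ge0 ?sqrtr_ge0// /c.
      by rewrite h4.
    rewrite [leRHS]mulrDl -[2 * _ * h ^+ 2]mulrA lerD//; first by rewrite ler_wpM2l.
    by rewrite ler_peMr ?exprn_ege1 ?normr_ge0.
  by rewrite /C le_eqVlt; apply/orP; left; apply/eqP; ring.
have n0 : 0 < n%:R :> R by exact: lt_le_trans n1.
rewrite ler_pdivrMr// /psi.
apply: (@le_trans _ _ (D * h ^+ 3)).
  rewrite /D -[leRHS]mulrA ler_wpM2l//.
  by rewrite -[h ^+ 3]ger0_norm ?exprn_ge0// -sqrtr_sqr -sqrtrM// ler_wsqrtr.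
rewrite -h4 (exprS h 3) [leRHS]mulrA ler_wpM2r ?exprn_ge0//.
by rewrite [leRHS]mulrC -ler_pdivrMr.
Qed.

Section Run.
Context (R : realType) (K : nat) (dX dZ d : measure_display).
Context (X : measurableType dX) (Z : measurableType dZ) (T : measurableType d).
Context (P : probability T R) (B : bandit R K X Z) (r : process R K X Z T).
Context (delta pimin : R).

(** * Deterministic bounds on the interval widths *)

Lemma residual_sqr_le (s : nat) (w : T) : 0 < pimin -> positivity r pimin ->
  residual B r s w ^+ 2 <= pimin ^- 2.
Proof.
move=> pimin0 pos; have := pos s w; rewrite /residual /pull_outcome /pull_score.
move: (outcome_itv B (arm r s w) (ctx r s w, latent r s w)).
move: (score_itv B (arm r s w) (ctx r s w, latent r s w)).
move: (score _ _ _) (outcome _ _ _) (propensity _ _ _) => f y p /andP[f0 f1] /andP[y0 y1] pp.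
have p0 : 0 < p by exact: lt_le_trans pp.
rewrite exprMn -[leRHS]mulr1 ler_pM ?sqr_ge0//.
  rewrite exprMn exprVn -[leRHS]mul1r ler_pM ?invr_ge0 ?sqr_ge0//.
    by case: (audit r s w); rewrite /= ?expr1n ?expr0n.
  by rewrite lef_pV2 ?posrE ?exprn_gt0// ler_pXn2r ?nnegrE// ltW.
rewrite -real_normK ?num_real// expr_le1// ler_norml.
by apply/andP; split; lra.
Qed.

Lemma residual_variation_itv (k : 'I_K) (t : nat) (w : T) :
  0 < pimin -> positivity r pimin ->
  0 <= residual_variation B r k t w <= pimin ^- 2 * (npulls r k t w)%:R.
Proof.
move=> pimin0 pos; apply/andP; split; first by apply: sumr_ge0 => s _; rewrite sqr_ge0.
rewrite /npulls natr_sum mulr_sumr; apply: ler_sum => s _.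
by rewrite mulr1 residual_sqr_le.
Qed.

(** Three terms get [eps / 3] each: [psi] of the pull count (slope [1/4]), [psi] of the residual
    variation (slope [pimin ^- 2]), and the additive constant [c]. As [N] depends on neither [t] nor
    [w], it can be fixed before a round is chosen. *)
Lemma widths_small (eps : R) : 0 < pimin -> positivity r pimin -> 0 < eps ->
  exists N : nat, forall k t w, (N <= npulls r k t w)%N ->
    width_score r delta k t w + width_residual B r delta pimin k t w <= eps.
Proof.
move=> pimin0 pos eps0.
have e3 : 0 < eps / 3 by rewrite divr_gt0.
have [|N1 N1P] := @psi_sublinear R 4^-1 (delta_arm K delta / 2) _ _ e3.
  by rewrite invr_ge0.
have [|N2 N2P] := @psi_sublinear R (pimin ^- 2) (delta_arm K delta / 2) _ _ e3.
  by rewrite invr_ge0 exprn_ge0// ltW.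
pose c := 45 / 100 * (2 / pimin) * ln (104 / 10 / delta_arm K delta).
pose N3 := (Num.truncn (`|c| / (eps / 3))).+1.
exists (maxn N1 (maxn N2 N3)) => k t w.
rewrite !geq_max => /and3P[n1 n2 n3].
have n0 : 0 < (npulls r k t w)%:R :> R by rewrite ltr0n (leq_trans _ n3).
have w1 : width_score r delta k t w <= eps / 3.
  apply: N1P => //; rewrite mulrC lexx andbT.
  by rewrite mulr_ge0 ?invr_ge0.
have w2 := N2P _ _ n2 (residual_variation_itv k t w pimin0 pos).
have w3 : c / (npulls r k t w)%:R <= eps / 3.
  rewrite ler_pdivrMr//; apply: (le_trans (ler_norm _)).
  rewrite mulrC -ler_pdivrMr//; apply/ltW/(lt_le_trans (truncnS_gt _)).
  by rewrite ler_nat.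
have -> : width_residual B r delta pimin k t w =
    psi (residual_variation B r k t w) (delta_arm K delta / 2) / (npulls r k t w)%:R
    + c / (npulls r k t w)%:R by rewrite /width_residual -/c; ring.
lra.
Qed.

(** * Counting pulls over the rounds *)

(** Positivity of [t] matters: through [t.-1], [pulls_before] takes the same value [K] at [0] and
    [1]. *)
Lemma npulls_round (k : 'I_K) (t : nat) (w : T) : (0 < t)%N ->
  npulls r k t.+1 w = (npulls r k t w + (arm r (pulls_before K t) w == k) +
                       (arm r (pulls_before K t).+1 w == k))%N.
Proof.
move=> t0; have e : pulls_before K t.+1 = (pulls_before K t).+2.
  by case: t t0 => // t _; rewrite /pulls_before /= mulnS !addnS addnA.
by rewrite /npulls e big_mkcond [in RHS]big_mkcond !big_nat_recr//=.
Qed.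

(* Each round with a rarely pulled leader or challenger raises
   \sum_k minn (npulls k) N, which is at most K * N. *)
Lemma often_pulled_round (N : nat) (w : T) (b c : nat -> 'I_K) :
  (forall t, (0 < t)%N -> [/\ b t != c t, arm r (pulls_before K t) w = b t &
                              arm r (pulls_before K t).+1 w = c t]) ->
  exists t, [/\ (0 < t)%N, (N <= npulls r (b t) t w)%N &
                (N <= npulls r (c t) t w)%N].
Proof.
move=> bc; apply: contrapT => no.
have few t : (0 < t)%N -> (t.-1 <= \sum_(k < K) minn (npulls r k t w) N)%N.
  elim: t => // -[//|t] IH _; apply: leq_ltn_trans (IH isT) _ => {IH}.
  have [bc' ab ac] := bc t.+1 isT.
  have mono k : (minn (npulls r k t.+1 w) N <= minn (npulls r k t.+2 w) N)%N.
    by rewrite leq_min geq_minr geq_min (@npulls_round k t.+1)// -addnA leq_addr.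
  have [j jb] : exists2 j, (npulls r j t.+1 w < N)%N & j = b t.+1 \/ j = c t.+1.
    have [lb|lb] := ltnP (npulls r (b t.+1) t.+1 w) N; first by exists (b t.+1) => //; left.
    have [lc|lc] := ltnP (npulls r (c t.+1) t.+1 w) N; first by exists (c t.+1) => //; right.
    by case: no; exists t.+1.
  move=> jP.
  rewrite (bigD1 j)//= [ltnRHS](bigD1 j)//= -addSn leq_add//; last exact: leq_sum.
  (* Leader and challenger differ, so exactly one of the two pulls of the round goes to [j]. *)
  have -> : npulls r j t.+2 w = (npulls r j t.+1 w).+1.
    rewrite (@npulls_round j t.+1)// ab ac.
    by case: jP => ->; rewrite eqxx ?(negbTE bc') 1?eq_sym ?(negbTE bc') ?addn0 addn1.
  by rewrite leq_min !(minn_idPl (ltnW jb)) leqnn.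
(* Before round [(K * N).+2] there are [(K * N).+1] completed rounds, one more than the capped sum
   allows. *)
have : (K * N < \sum_(k < K) minn (npulls r k (K * N).+2 w) N)%N by exact: (few (K * N).+2 isT).
rewrite ltnNge => /negP; apply.
have -> : (K * N = \sum_(k < K) N)%N by rewrite sum_nat_const card_ord.
by apply: leq_sum => k _; exact: geq_minr.
Qed.

(** * Correctness and termination on the coverage event *)

Let covered (w : T) := forall t, (0 < t)%N -> forall k,
  lower B r delta pimin k t w <= theta B k <= upper B r delta pimin k t w.

(** This holds for every best arm at once, so with ties a covered run never stops: its leader would
    have to equal two different arms. Termination is therefore sought only for a unique best arm. *)
Lemma covered_leader_best (kstar : 'I_K) (t : nat) (w : T) :
  best_arm B kstar -> covered w -> stop_round B r delta pimin t w ->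
  leader r t w = kstar.
Proof.
move=> best cov /andP[t0 /forallP /(_ kstar)].
have [//|_ /= st] := eqVneq kstar (leader r t w).
have /andP[_ us] := cov t t0 kstar.
have /andP[lb _] := cov t t0 (leader r t w).
by have := lt_le_trans (le_lt_trans us st) lb; rewrite ltNge best.
Qed.

(** Replaces [ex_minn] by a first stopping round, a form that serves both correctness and the
    countable decomposition behind measurability. *)
Lemma outputP (w : T) (k : 'I_K) :
  output B r delta pimin w = Some k <->
  exists t, [/\ stop_round B r delta pimin t w,
    forall t', (t' < t)%N -> ~~ stop_round B r delta pimin t' w &
    leader r t w = k].
Proof.
rewrite /output; case: pselect => [e|no]; last first.
  by split=> // -[t [st _ _]]; case: no; exists t.
case: ex_minnP => m sm minm; split=> [[<-]|[t [st before <-]]].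
  exists m; split=> // t' lt; apply/negP => /minm; by rewrite leqNgt lt.
suff -> : m = t by [].
apply/eqP; rewrite eqn_leq minm//= leqNgt; apply/negP => /before.
by rewrite sm.
Qed.

Lemma covered_output (kstar k : 'I_K) (w : T) :
  best_arm B kstar -> covered w -> output B r delta pimin w = Some k ->
  k = kstar.
Proof. by move=> best cov /outputP[t [st _ <-]]; exact: (covered_leader_best best cov st). Qed.

Lemma unique_best_gap (kstar : 'I_K) :
  best_arm B kstar -> (forall k, best_arm B k -> k = kstar) ->
  exists2 gap : R, 0 < gap &
    forall k, k != kstar -> theta B k + gap <= theta B kstar.
Proof.
move=> best uniq.
(* The default [1] keeps the gap positive when there is no other arm. *)
exists (\big[Num.min/1]_(k | k != kstar) (theta B kstar - theta B k)).
  apply: lt_bigmin => // k; apply: contraNlt => nk; apply/eqP/uniq => j.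
  by apply: (le_trans (best j)); rewrite -subr_le0.
by move=> k nk; rewrite addrC -lerBrDr; exact: bigmin_le_cond.
Qed.

Lemma covered_stops (kstar : 'I_K) (w : T) :
  pplucb B r delta pimin P -> 0 < pimin -> positivity r pimin ->
  best_arm B kstar -> (forall k, best_arm B k -> k = kstar) -> covered w ->
  exists t, stop_round B r delta pimin t w.
Proof.
move=> algo pi0 pos best uniq cov; apply: contrapT => never.
have nostop t : ~~ stop_round B r delta pimin t w by apply/negP => st; case: never; exists t.
have [gap gap0 gapP] := unique_best_gap best uniq.
have e0 : 0 < gap / 8 by rewrite divr_gt0.
have [N small] := widths_small pi0 pos e0.
have [|t [t0 /small wb /small wc]] := @often_pulled_round N w (leader r ^~ w) (challenger r ^~ w).
  move=> t t0.
  have [cb _] := challengerP algo t0 (fun t' _ => nostop t').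
  by have [] := round_arms algo t0 (fun t' _ => nostop t'); split=> //; rewrite eq_sym.
have [cb cU] := challengerP algo t0 (fun t' _ => nostop t').
have lead := leaderP algo w (challenger r t w) t0.
have : ~~ stops B r delta pimin t w by have := nostop t; rewrite /stop_round t0.
rewrite negb_forall => /existsP[k]; rewrite negb_imply -leNgt => /andP[kb Lk].
have Uk := cU k kb.
have /andP[b1 b2] := cov t t0 (leader r t w).
have /andP[c1 c2] := cov t t0 (challenger r t w).
move: wb wc lead Lk Uk b1 b2 c1 c2 cb cU; rewrite /lower /upper.
(* If the leader is best, [U_c >= U_k >= L_b] bounds [theta_b - theta_c] by two interval lengths,
   that is [gap / 2]. *)
have [->|bs] := eqVneq (leader r t w) kstar.
  have [->|cs] := eqVneq (challenger r t w) kstar; first by [].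
  have := gapP _ cs; move=> *; lra.
(* If the challenger is best, the leader's larger estimate bounds [theta_c - theta_b] by two
   half-widths, that is [gap / 4]. *)
have [->|cs] := eqVneq (challenger r t w) kstar.
  have := gapP _ bs; move=> *; lra.
(* Otherwise [kstar] competed for the challenger's place, so [U_c] is at least [theta B kstar],
   while it exceeds [theta_c] by at most [gap / 4]. *)
have := gapP _ cs; have /andP[_ ] := cov t t0 kstar; rewrite /upper.
move=> s1 g wb wc _ _ _ _ _ c1 c2 _ /(_ kstar); rewrite eq_sym bs => /(_ isT).
lra.
Qed.

(** * Measurability of the statistics, the output and the coverage event *)

Lemma measurable_arm_eq (s : nat) (k : 'I_K) : pplucb B r delta pimin P ->
  measurable_fun [set: T] (fun w => arm r s w == k).
Proof.
move=> algo; apply: (measurable_fun_bool true); rewrite setTI.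
rewrite (_ : _ @^-1` _ = arm r s @^-1` [set k]); first exact: (arm_measurable algo).
by apply/seteqP; split=> w /= /eqP.
Qed.

Lemma measurable_pull (f : 'I_K -> X * Z -> R) (s : nat) :
  pplucb B r delta pimin P ->
  (forall k, measurable_fun [set: X * Z] (f k)) ->
  measurable_fun [set: T] (fun w => f (arm r s w) (ctx r s w, latent r s w)).
Proof.
move=> algo mf.
apply: (measurable_fun_select (f := fun k w => f k (ctx r s w, latent r s w))).
  exact: (arm_measurable algo).
move=> k; apply: (measurableT_comp (mf k)); apply: measurable_fun_pair.
  exact: (ctx_measurable algo).
exact: (latent_measurable algo).
Qed.

Lemma measurable_pull_score (s : nat) : pplucb B r delta pimin P ->
  measurable_fun [set: T] (pull_score B r s).
Proof. by move=> algo; apply: measurable_pull => // k; exact: score_measurable. Qed.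

Lemma measurable_pull_outcome (s : nat) : pplucb B r delta pimin P ->
  measurable_fun [set: T] (pull_outcome B r s).
Proof. by move=> algo; apply: measurable_pull => // k; exact: outcome_measurable. Qed.

(** The propensity is only given as measurable with respect to this generated sigma-algebra; the
    inclusion makes it a random variable on [T]. *)
Lemma before_audit_measurable (s : nat) : pplucb B r delta pimin P ->
  before_audit B r s `<=` measurable.
Proof.
move=> algo.
have marm s' : arm_events r s' `<=` measurable.
  move=> _ [S _ <-]; rewrite (_ : _ @^-1` _ = \bigcup_(k in S) (arm r s' @^-1` [set k])).
    apply: fin_bigcup_measurable; first exact: finite_finset.
    by move=> k _; exact: (arm_measurable algo).
  by apply/seteqP; split=> w /= => [Sw|[k Sk /= ->]//]; exists (arm r s' w).
have pre (d' : measure_display) (T' : measurableType d') (f : T -> T') :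
    measurable_fun [set: T] f -> preimage_set_system [set: T] f measurable `<=` measurable.
  by move=> mf _ [Y mY <-]; exact: mf.
have mctx s' := pre _ _ _ (ctx_measurable algo s').
have mscore s' := pre _ _ _ (measurable_pull_score s' algo).
have maudit s' := pre _ _ _ (audit_measurable algo s').
have mout s' : audited_outcome_events B r s' `<=` measurable.
  apply: pre; apply: measurable_fun_ifT => //; first exact: (audit_measurable algo).
  exact: measurable_pull_outcome.
apply: smallest_sub; first exact: sigma_algebra_measurable.
by move=> E [[[[s' _ [[[[|]|]|]|]]|]|]|]; [exact: marm|exact: mctx|exact: mscore|
  exact: maudit|exact: mout|exact: marm|exact: mctx|exact: mscore].
Qed.

Lemma measurable_residual (s : nat) : pplucb B r delta pimin P ->
  measurable_fun [set: T] (residual B r s).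
Proof.
move=> algo; apply: measurable_funM; last first.
  by apply: measurable_funB; [exact: measurable_pull_outcome|exact: measurable_pull_score].
apply: measurable_funM.
  rewrite (_ : (fun _ => _) = fun w => if audit r s w then 1 else 0 : R).
    by apply: measurable_fun_ifT => //; exact: (audit_measurable algo).
  by apply/funext => w; case: (audit r s w).
apply: measurable_funV => _ S mS; rewrite setTI.
apply: (before_audit_measurable algo).
by have [mp _] := propensityP algo s; exact: mp.
Qed.

Lemma measurable_arm_sum (k : 'I_K) (t : nat) (f : nat -> T -> R) :
  pplucb B r delta pimin P -> (forall s, measurable_fun [set: T] (f s)) ->
  measurable_fun [set: T]
    (fun w => \sum_(0 <= s < pulls_before K t | arm r s w == k) f s w).
Proof.
(* Moving the random condition on the arm into the summand leaves a sum over a deterministic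
   range. *)
move=> algo mf; under eq_fun do rewrite big_mkcond.
apply: measurable_sum => s; apply: measurable_fun_ifT => //.
exact: measurable_arm_eq.
Qed.

Lemma measurable_npulls (k : 'I_K) (t : nat) : pplucb B r delta pimin P ->
  measurable_fun [set: T] (fun w => (npulls r k t w)%:R : R).
Proof.
by move=> algo; under eq_fun do rewrite natr_sum; exact: measurable_arm_sum.
Qed.

Lemma measurable_theta_hat (k : 'I_K) (t : nat) : pplucb B r delta pimin P ->
  measurable_fun [set: T] (theta_hat B r k t).
Proof.
move=> algo; have mV := measurable_funV (measurable_npulls k t algo).
apply: measurable_funD; apply: measurable_funM => //; apply: measurable_arm_sum => // s.
  exact: measurable_pull_score.
exact: measurable_residual.
Qed.

Lemma measurable_width_score (k : 'I_K) (t : nat) : pplucb B r delta pimin P ->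
  measurable_fun [set: T] (width_score r delta k t).
Proof.
move=> algo; apply: measurable_funM; last exact/measurable_funV/measurable_npulls.
apply: measurable_psi; apply: measurable_funM => //; exact: measurable_npulls.
Qed.

Lemma measurable_width_residual (k : 'I_K) (t : nat) :
  pplucb B r delta pimin P ->
  measurable_fun [set: T] (width_residual B r delta pimin k t).
Proof.
move=> algo; apply: measurable_funM; first exact/measurable_funV/measurable_npulls.
apply: measurable_funD => //; apply/measurable_psi/measurable_arm_sum => // s.
exact/measurable_funX/measurable_residual.
Qed.

Lemma measurable_lower (k : 'I_K) (t : nat) : pplucb B r delta pimin P ->
  measurable_fun [set: T] (lower B r delta pimin k t).
Proof.
move=> algo; apply: measurable_funB; last exact: measurable_width_residual.
by apply: measurable_funB; [exact: measurable_theta_hat|exact: measurable_width_score].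
Qed.

Lemma measurable_upper (k : 'I_K) (t : nat) : pplucb B r delta pimin P ->
  measurable_fun [set: T] (upper B r delta pimin k t).
Proof.
move=> algo; apply: measurable_funD; last exact: measurable_width_residual.
by apply: measurable_funD; [exact: measurable_theta_hat|exact: measurable_width_score].
Qed.

Lemma measurable_stop_round (t : nat) : pplucb B r delta pimin P ->
  measurable_fun [set: T] (stop_round B r delta pimin t).
Proof.
move=> algo; apply: measurable_and => //.
apply: (measurable_fun_select (f := fun b w => [forall k, (k != b) ==>
  (upper B r delta pimin k t w < lower B r delta pimin b t w)])).
  exact: (leader_measurable algo).
move=> b; apply: measurable_fun_forall => k; case: (k != b) => //=.
by apply: measurable_fun_ltr; [exact: measurable_upper|exact: measurable_lower].
Qed.

Lemma measurable_output (k : 'I_K) : pplucb B r delta pimin P ->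
  measurable [set w | output B r delta pimin w = Some k].
Proof.
move=> algo; have mstop t := measurable_stop_round t algo.
have -> : [set w | output B r delta pimin w = Some k] =
    \bigcup_t (stop_round B r delta pimin t @^-1` [set true] `&`
      (\bigcap_(t' in [set t' | (t' < t)%N])
         (stop_round B r delta pimin t' @^-1` [set false]) `&`
       leader r t @^-1` [set k])).
  apply/seteqP; split=> w /=.
    move=> /outputP[t [st before lt]]; exists t => //=; split=> //; split=> //.
    by move=> t' /= /before /negbTE.
  move=> [t _ /= [st [before lt]]]; apply/outputP; exists t; split=> //.
  by move=> t' /before /= ->.
apply: bigcup_measurable => t _; apply: measurableI.
  by rewrite -[X in measurable X]setTI; exact: mstop.
apply: measurableI; last exact: (leader_measurable algo).
(* For [t = 0] the intersection is over an empty family, whereas [bigcap_measurable] is applied to a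
   nonempty one. *)
have [->|t0] := posnP t.
  by rewrite (_ : mkset _ = set0) ?bigcap_set0// -subset0 => t'.
apply: bigcap_measurable; first by exists 0%N.
by move=> t' _; rewrite -[X in measurable X]setTI; exact: mstop.
Qed.

Lemma measurable_covered : pplucb B r delta pimin P -> measurable [set w | covered w].
Proof.
move=> algo.
rewrite (_ : mkset _ = \bigcap_(t in [set t | (0 < t)%N])
    ((fun w => [forall k, (lower B r delta pimin k t w <= theta B k) &&
                (theta B k <= upper B r delta pimin k t w)]) @^-1` [set true])).
  apply: bigcap_measurable; first by exists 1%N.
  move=> t _; rewrite -[X in measurable X]setTI.
  suff : measurable_fun [set: T] (fun w => [forall k,
    (lower B r delta pimin k t w <= theta B k) &&
    (theta B k <= upper B r delta pimin k t w)]) by apply.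
  apply: measurable_fun_forall => k; apply: measurable_and.
    by apply: measurable_fun_ler => //; exact: measurable_lower.
  by apply: measurable_fun_ler => //; exact: measurable_upper.
apply/seteqP; split=> w /= cov t t0; first by apply/forallP => k; exact: cov.
by move=> k; have /forallP := cov t t0; apply.
Qed.

End Run.

Theorem theorem5p1 (R : realType) (K : nat) (dX dZ d : measure_display)
    (X : measurableType dX) (Z : measurableType dZ) (T : measurableType d)
    (P : probability T R) (B : bandit R K X Z) (r : process R K X Z T)
    (delta pimin : R) (kstar : 'I_K) :
  0 < delta < 1 ->
  0 < pimin <= 1 ->
  best_arm B kstar ->
  pplucb B r delta pimin P ->
  audit_ignorability B r P ->
  positivity r pimin ->
  simultaneous_coverage B r delta pimin P ->
  delta_correct_if_stopped B r delta pimin P kstar /\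
  ((forall k, best_arm B k -> k = kstar) ->
     delta_correct B r delta pimin P kstar).
Proof.
move=> _ /andP[pimin0 _] best algo _ pos cov.
have mcov := measurable_covered algo.
split=> [|uniq]; apply: (le_trans cov); apply: le_measure; rewrite ?inE //.
(* The event of no wrong output is the complement of a finite union of output events; it contains
   the runs that never stop. *)
- rewrite (_ : mkset _ = ~` \bigcup_(k in [set k | k != kstar])
      [set w | output B r delta pimin w = Some k]).
    apply: measurableC; apply: fin_bigcup_measurable; first exact: finite_finset.
    by move=> k _; exact: (measurable_output _ algo).
  apply/seteqP; split=> w /= => [out [k /= /eqP nk /out //]|nout k out].
  by apply: contrapT => /eqP nk; apply: nout; exists k.
- by move=> w /= covw k; exact: covered_output.
- exact: (measurable_output _ algo).
(* Uniqueness makes the covered run stop, which rules out [None]; the value is then forced by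
   coverage. *)
- move=> w /= covw; have [t st] := covered_stops algo pimin0 pos best uniq covw.
  case out : (output B r delta pimin w) => [k|].
    by rewrite -(covered_output best covw out).
  move: out; rewrite /output; case: pselect => // no; case: no; by exists t.
Qed.
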